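(* Let $K$ be a compact metric space, $\Phi=\{\varphi_1,\dots,\varphi_n\}$ a system of linearly independent functions in $C(K)$, $\mathcal{P}$ the space of polynomials by the system $\Phi$, $L=\{\ell_j\}_{j=1}^r$, $r<n$, a set of linearly independent linear functionals on $\mathcal{P}$, and $b_1,\dots,b_r\in\mathbb{R}$. For every $f\in C(K)$, all polynomials of best approximation for $f$ from $\mathcal{P}$ under the constraints $\ell_j(p)=b_j$, $j=1,\dots,r$, have the same $L$-alternance and the same values on it. That is, there exist points $\tau_1,\dots,\tau_m\in K$ such that $\{\tau_i\}_{i=1}^m$ is an $L$-alternance of every polynomial $p$ of best approximation for $f$ under these constraints and, for each $i$, the value $p(\tau_i)$ is the same for all such $p$.
   Context: $C(K)$ is the space of continuous real functions on $K$ with the uniform norm $\|g\|=\max_{t\in K}|g(t)|$. A polynomial by the system $\Phi$ is a linear combination $p=\sum_{k=1}^n p^k\varphi_k$, $p^k\in\mathbb{R}$, with coefficient vector $\boldsymbol{p}=(p^1,\dots,p^n)\in\mathbb{R}^n$; $\mathcal{P}$ is the linear space of all of them, identified with $\mathbb{R}^n$. A polynomial $p\in\mathcal{P}$ is of best approximation for $f$ under the constraints if $\ell_j(p)=b_j$ for all $j$ and $\|p-f\|\le\|q-f\|$ for all $q\in\mathcal{P}$ with $\ell_j(q)=b_j$, $j=1,\dots,r$. The moment vector is $\boldsymbol{u}(t)=(\varphi_1(t),\dots,\varphi_n(t))^T\in\mathbb{R}^n$. Each $\ell_j$ is associated with the vector $\boldsymbol{\ell}_j\in\mathbb{R}^n$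 such that $\ell_j(p)=(\boldsymbol{\ell}_j,\boldsymbol{p})$ (Euclidean inner product), and $L^\perp\subset\mathbb{R}^n$ is the orthogonal complement of $\boldsymbol{\ell}_1,\dots,\boldsymbol{\ell}_r$, so $\dim L^\perp=n-r$. Projection means orthogonal projection. $L$-alternance: given $f$, a polynomial $p\in\mathcal{P}$ has an $L$-alternance $\{\tau_1,\dots,\tau_m\}$, where $\tau_i\in K$ and $1\le m\le n-r+1$, if there are signs $\sigma_1,\dots,\sigma_m\in\{-1,1\}$ such that (1) $p(\tau_i)-f(\tau_i)=\sigma_i\|p-f\|$ for $i=1,\dots,m$; and (2) the convex hull of the orthogonal projections of the vectors $\{\sigma_i\boldsymbol{u}(\tau_i)\}_{i=1}^m$ onto $L^\perp$ contains the origin. The points are given as an indexed list; they are not required to be distinct. *)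

(* Defs.v *)
(* MathComp-Analysis, over an abstract [R : realType]. *)
From mathcomp Require Import all_boot all_order all_algebra.
From mathcomp Require Import all_classical all_reals all_analysis.

Set Implicit Arguments.
Unset Strict Implicit.
Unset Printing Implicit Defensive.

Import Order.TTheory GRing.Theory Num.Theory numFieldNormedType.Exports.

Local Open Scope classical_set_scope.
Local Open Scope ring_scope.

(* For [g] continuous on a nonempty compact [K] the supremum is a maximum. *)
Definition unif_norm (R : realType) (K : Type) (g : K -> R) : R :=
  sup (range (fun t => `|g t|)).

(* Used both for functions on [K] and for functionals on coefficient vectors. *)
Definition lin_indep (R : realType) (T : Type) (m : nat) (g : 'I_m -> T -> R)
  : Prop :=
  forall c : 'I_m -> R, (forall x, \sum_i c i * g i x = 0) ->
    forall i, c i = 0.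

Definition conv_hull (R : realType) (n m : nat) (y : 'I_m -> 'rV[R]_n)
  : set 'rV[R]_n :=
  [set x | exists w : 'I_m -> R,
    [/\ forall i, 0 <= w i, \sum_i w i = 1 & x = \sum_i w i *: y i]].

(* Subspaces of R^n are represented by row spaces of matrices: the row space
   of [ortho_compl A] consists of the [x] with [x *m A^T = 0], i.e. whose
   Euclidean inner product with each row of [A] vanishes. *)
Definition ortho_compl (R : realType) (m n : nat) (A : 'M[R]_(m, n))
  : 'M[R]_n := kermx A^T.

Definition ortho_proj (R : realType) (n : nat) (V : 'M[R]_n) : 'M[R]_n :=
  proj_mx V (ortho_compl V).

Lemma ortho_projP (R : realType) (n : nat) (V : 'M[R]_n) (x : 'rV[R]_n) :
  (x *m ortho_proj V <= V)%MS /\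
  forall v : 'rV[R]_n, (v <= V)%MS -> (x - x *m ortho_proj V) *m v^T = 0.
Proof.
have V0 : (V :&: ortho_compl V = 0)%MS.
  apply/eqP/rowV0P => v; rewrite sub_capmx => /andP[/submxP[w ->]].
  move/sub_kermxP => h.
  have {h} : (w *m V) *m (w *m V)^T = 0 by rewrite trmx_mul mulmxA h mul0mx.
  move/matrixP/(_ 0 0); rewrite mxE [RHS]mxE => h.
  apply/rowP => j; rewrite [RHS]mxE; apply/eqP.
  have : \sum_k (w *m V) 0 k ^+ 2 == 0.
    by apply/eqP; rewrite -[RHS]h; apply: eq_bigr => k _;
      rewrite [_^T _ _]mxE expr2.
  rewrite psumr_eq0; last by move=> k _; exact: sqr_ge0.
  by move=> /allP/(_ j); rewrite mem_index_enum sqrf_eq0; apply.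
have V1 : (x <= V + ortho_compl V)%MS.
  apply: submx_full; rewrite /row_full mxrank_disjoint_sum //.
  by rewrite mxrank_ker mxrank_tr subnKC // rank_leq_col.
split=> [|v /submxP[w ->]]; first exact: proj_mx_sub.
have := proj_mx_compl_sub V1.
by move=> /sub_kermxP h; rewrite trmx_mul mulmxA h mul0mx.
Qed.

(* A polynomial is identified with its coefficient vector [p : 'rV[R]_n]. *)
Definition poly_fun (R : realType) (K : Type) (n : nat) (phi : 'I_n -> K -> R)
  (p : 'rV[R]_n) : K -> R :=
  fun t => \sum_k p 0 k * phi k t.

Definition moment (R : realType) (K : Type) (n : nat) (phi : 'I_n -> K -> R)
  (t : K) : 'rV[R]_n :=
  \row_k phi k t.

(* Row [j] is the vector representing [ell j] for the Euclidean inner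
   product: its coordinates are the values of [ell j] on the unit vectors. *)
Definition functionals_mx (R : realType) (n r : nat)
  (ell : 'I_r -> {scalar 'rV[R]_n}) : 'M[R]_(r, n) :=
  \matrix_(j, k) ell j (delta_mx 0 k).

Definition L_perp (R : realType) (n r : nat)
  (ell : 'I_r -> {scalar 'rV[R]_n}) : 'M[R]_n :=
  ortho_compl (functionals_mx ell).

Definition best_approx (R : realType) (K : Type) (n r : nat)
  (phi : 'I_n -> K -> R) (ell : 'I_r -> {scalar 'rV[R]_n}) (b : 'I_r -> R)
  (f : K -> R) (p : 'rV[R]_n) : Prop :=
  (forall j, ell j p = b j) /\
  forall q : 'rV[R]_n, (forall j, ell j q = b j) ->
    unif_norm (fun t => poly_fun phi p t - f t) <=
    unif_norm (fun t => poly_fun phi q t - f t).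

Definition L_alternance (R : realType) (K : Type) (n r : nat)
  (phi : 'I_n -> K -> R) (ell : 'I_r -> {scalar 'rV[R]_n})
  (f : K -> R) (p : 'rV[R]_n) (m : nat) (tau : 'I_m -> K) : Prop :=
  (1 <= m <= n - r + 1)%N /\
  exists sigma : 'I_m -> R,
    [/\ forall i, sigma i = -1 \/ sigma i = 1,
        forall i, poly_fun phi p (tau i) - f (tau i) =
          sigma i * unif_norm (fun t => poly_fun phi p t - f t)
      & conv_hull (fun i : 'I_m =>
          (sigma i *: moment phi (tau i)) *m ortho_proj (L_perp ell)) 0].

(* Main.v *)
Require Import Defs.
From mathcomp Require Import all_boot all_order all_algebra.
From mathcomp Require Import all_classical all_reals all_analysis.
From mathcomp Require Import ring lra.

Set Implicit Arguments.
Unset Strict Implicit.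
Unset Printing Implicit Defensive.

Import Order.TTheory GRing.Theory Num.Theory numFieldNormedType.Exports.

Local Open Scope classical_set_scope.
Local Open Scope ring_scope.

(** Let p be one best approximant, e = p - f its error and E = ||e||.  The
    heart of the proof is that p has an alternance (tau, sigma) whose convex
    combination
      sum_i w_i P(sigma_i u(tau_i)) = 0,   P the projection onto L^perp,
    has strictly positive weights ([positive_alternance]).  Such an alternance
    is shared by every other best approximant q ([eq_on_positive_alternance]):
    p - q lies in L^perp, so pairing the relation with p - q gives
      sum_i w_i sigma_i (p - q)(tau_i) = 0.
    Since ||q - f|| = E too, sigma_i (q - f)(tau_i) <= E =
    sigma_i (p - f)(tau_i), so every term of this sum is nonnegative; the
    weights being positive, p and q agree at each tau_i.  Hence q - f takes
    the values sigma_i E at the tau_i, and the same signs and weights serve q.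

    To obtain the alternance, both of its requirements are encoded in a single
    convex hull in R^(n+1), that of the compact set S of the vectors
      v(s, t) = (P(s u(t)), E - s e(t)),   t in K, s = 1 or s = -1.
    The last coordinate is nonnegative on S, so if 0 is a convex combination
    of points of S, those with positive weight have E = s e(t), and their
    first components have 0 in their convex hull.  If 0 is not in the hull,
    the hull has a point (x, lam) of least norm, and
      s x(t) + lam (E - s e(t)) >= c > 0   for all t and s
    ([origin_or_separated]).  Then lam > 0, because lam = 0 would give both
    x(t) >= c and - x(t) >= c; dividing by lam, |e - x / lam| <= E - c / lam
    on K, so p - x / lam satisfies the constraints and is strictly better than
    p ([not_best_of_descent]).

    Caratheodory's theorem enters in two places: in R^(n+1), where bounding
    the number of points makes the convex hull compact, so that a point of
    least norm exists, and in L^perp, where it brings the alternance down to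
    n - r + 1 points with positive weights. *)

(** * Caratheodory's theorem *)

(** The rows (y_i, 1) lie in a space of dimension \rank V + 1, so more of them
    than that are linearly dependent.  The positive coefficient is what
    [caratheodory_step] moves along. *)
Lemma affine_dependence (R : realType) (n m : nat) (V : 'M[R]_n)
    (y : 'I_m -> 'rV[R]_n) :
  (forall i, (y i <= V)%MS) -> ((\rank V).+1 < m)%N ->
  exists c : 'I_m -> R,
    [/\ \sum_i c i = 0, \sum_i c i *: y i = 0 & exists i, 0 < c i].
Proof.
move=> yV rankV.
pose Y := \matrix_i y i.
have YV : (Y <= V)%MS by apply/row_subP => i; rewrite rowK.
pose M := row_mx Y (const_mx 1 : 'cV[R]_m).
have rankM : (\rank M < m)%N.
  apply: leq_ltn_trans rankV.
  rewrite -mxrank_tr tr_row_mx -addsmxE.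
  apply: leq_trans (mxrank_adds_leqif _ _) _.
  by rewrite -(addn1 (\rank V)) leq_add ?rank_leq_row // mxrank_tr mxrankS.
have /rowV0Pn[v /sub_kermxP vM v0] : kermx M != 0.
  by rewrite kermx_eq0 /row_free neq_ltn rankM.
move: vM; rewrite mul_mx_row -(row_mx0 _ 1 n 1) => /eq_row_mx[vY v1].
have sumv : \sum_i v 0 i = 0.
  have /matrixP/(_ 0 0) := v1; rewrite !mxE; apply: etrans.
  by apply: eq_bigr => i _; rewrite mxE mulr1.
exists (v 0); split=> //.
  by rewrite -[RHS]vY mulmx_sum_row; apply: eq_bigr => i _; rewrite rowK.
apply: contrapT => /forallNP nonpos.
case/eqP: v0; apply/rowP => i; rewrite [RHS]mxE; apply/eqP.
have le0 j : 0 <= - v 0 j by rewrite oppr_ge0 leNgt; apply/negP/nonpos.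
have : \sum_j - v 0 j == 0 by rewrite sumrN sumv oppr0.
rewrite psumr_eq0 // => /allP/(_ i); rewrite mem_index_enum oppr_eq0.
exact.
Qed.

(** Subtracting t times an affine dependence c from the weights keeps both the
    sum of the weights and the represented point; the largest t that keeps the
    weights nonnegative makes one of them vanish. *)
Lemma caratheodory_step (R : realType) (n m : nat) (V : 'M[R]_n)
    (y : 'I_m -> 'rV[R]_n) (x : 'rV[R]_n) :
  (forall i, (y i <= V)%MS) -> ((\rank V).+1 < m)%N -> conv_hull y x ->
  exists w : 'I_m -> R,
    [/\ forall i, 0 <= w i, \sum_i w i = 1, x = \sum_i w i *: y i
      & exists i, w i = 0].
Proof.
move=> yV rankV [w [w0 w1 ->]].
have [c [c0 cy [i0 ci0]]] := affine_dependence yV rankV.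
case: (@Order.TotalTheory.arg_minP _ _ _ i0 (fun i => 0 < c i)
  (fun i => w i / c i) ci0) => k ck kmin.
pose t := w k / c k.
exists (fun i => w i - t * c i); split.
- move=> i; rewrite subr_ge0.
  have [ci|ci] := ltP 0 (c i); first by rewrite -ler_pdivlMr //; exact: kmin.
  apply: le_trans (w0 i); apply: mulr_ge0_le0 => //.
  by apply: divr_ge0 => //; exact: ltW.
- by rewrite sumrB -mulr_sumr c0 mulr0 subr0.
- under [RHS]eq_bigr do rewrite scalerBl -scalerA.
  by rewrite sumrB -scaler_sumr cy scaler0 subr0.
- by exists k; rewrite /t divfK ?subrr // gt_eqF.
Qed.

Lemma drop_zero_weight (R : realType) (n m : nat) (y : 'I_m.+1 -> 'rV[R]_n)
    (w : 'I_m.+1 -> R) (k : 'I_m.+1) :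
  (forall i, 0 <= w i) -> \sum_i w i = 1 -> w k = 0 ->
  conv_hull (fun i => y (lift k i)) (\sum_i w i *: y i).
Proof.
move=> w0 w1 wk; exists (fun i => w (lift k i)); split=> //.
  by rewrite -w1 (bigD1_ord k) //= wk add0r.
by rewrite (bigD1_ord k) //= wk scale0r add0r.
Qed.

(** The subfamily is given by an index map h, so that whatever labels the points
    y_i carry (here, points of K and signs) are inherited.  The weights are
    positive, which is stronger than membership in the hull and is what makes
    an alternance common to all best approximants. *)
Lemma caratheodory (R : realType) (n m : nat) (V : 'M[R]_n)
    (y : 'I_m -> 'rV[R]_n) (x : 'rV[R]_n) :
  (forall i, (y i <= V)%MS) -> conv_hull y x ->
  exists (m' : nat) (h : 'I_m' -> 'I_m) (w : 'I_m' -> R),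
    [/\ (m' <= (\rank V).+1)%N, forall i, 0 < w i, \sum_i w i = 1
      & x = \sum_i w i *: y (h i)].
Proof.
elim: m y => [|m IH] y yV.
  by case=> w [_ + _]; rewrite big_ord0 => /esym/eqP; rewrite oner_eq0.
have drop w : (forall i, 0 <= w i) -> \sum_i w i = 1 ->
    (exists k, w k = 0) -> x = \sum_i w i *: y i ->
    exists (m' : nat) (h : 'I_m' -> 'I_m.+1) (w : 'I_m' -> R),
    [/\ (m' <= (\rank V).+1)%N, forall i, 0 < w i, \sum_i w i = 1
      & x = \sum_i w i *: y (h i)].
  move=> w0 w1 [k wk] xE; have := drop_zero_weight y w0 w1 wk.
  rewrite -xE => /IH[|m' [h [w' [? ? ? ?]]]]; first by move=> i; exact: yV.
  by exists m', (fun i => lift k (h i)), w'.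
move=> hull_x; have [small|big] := leqP m.+1 (\rank V).+1; last first.
  by have [w [w0 w1 xE wk]] := caratheodory_step yV big hull_x; exact: drop xE.
have [w [w0 w1 xE]] := hull_x.
have [wk|/forallNP wn0] := pselect (exists k, w k = 0); first exact: drop xE.
exists m.+1, id, w; split=> // i; rewrite lt_def w0 andbT.
by apply/eqP; exact: wn0.
Qed.

(** * The Euclidean inner product *)

Definition dot (R : realType) (n : nat) (x y : 'rV[R]_n) : R := (x *m y^T) 0 0.

Lemma dotE (R : realType) (n : nat) (x y : 'rV[R]_n) :
  dot x y = \sum_k x 0 k * y 0 k.
Proof. by rewrite /dot mxE; under eq_bigr do rewrite mxE. Qed.

Lemma dotC (R : realType) (n : nat) (x y : 'rV[R]_n) : dot x y = dot y x.
Proof. by rewrite !dotE; apply: eq_bigr => k _; rewrite mulrC. Qed.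

Lemma dotDr (R : realType) (n : nat) (x y z : 'rV[R]_n) :
  dot x (y + z) = dot x y + dot x z.
Proof. by rewrite /dot linearD mulmxDr mxE. Qed.

Lemma dotZr (R : realType) (n : nat) (a : R) (x y : 'rV[R]_n) :
  dot x (a *: y) = a * dot x y.
Proof. by rewrite /dot linearZ -scalemxAr mxE. Qed.

Lemma dot_sumr (R : realType) (n m : nat) (x : 'rV[R]_n) (w : 'I_m -> R)
    (y : 'I_m -> 'rV[R]_n) :
  dot x (\sum_i w i *: y i) = \sum_i w i * dot x (y i).
Proof.
rewrite /dot linear_sum mulmx_sumr summxE; apply: eq_bigr => i _.
by rewrite linearZ -scalemxAr mxE.
Qed.

Lemma dot_ge0 (R : realType) (n : nat) (x : 'rV[R]_n) : 0 <= dot x x.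
Proof. by rewrite dotE sumr_ge0 // => k _; rewrite -expr2 sqr_ge0. Qed.

Lemma dot_eq0 (R : realType) (n : nat) (x : 'rV[R]_n) : dot x x = 0 -> x = 0.
Proof.
rewrite dotE => /eqP; rewrite psumr_eq0; last first.
  by move=> k _; rewrite -expr2 sqr_ge0.
move=> /allP xx; apply/rowP => k; rewrite [RHS]mxE.
by have := xx k; rewrite mem_index_enum mulf_eq0 orbb => /(_ isT)/eqP.
Qed.

(** First-order condition for x to be the point of least norm of the segment
    from x to s: the derivative of the squared norm at x in the direction
    s - x is 2 (x, s - x), which must be nonnegative. *)
Lemma min_norm_segment (R : realType) (n : nat) (x s : 'rV[R]_n) :
  (forall t, 0 <= t <= 1 -> let z := (1 - t) *: x + t *: s in
     dot x x <= dot z z) ->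
  dot x x <= dot x s.
Proof.
move=> xmin; rewrite leNgt; apply/negP => lt_xs.
pose a := dot x x - dot x s; pose b := dot x x + dot s s - 2 * dot x s.
have a_gt0 : 0 < a by rewrite subr_gt0.
have b_ge0 : 0 <= b.
  have := dot_ge0 (x + (-1) *: s).
  rewrite dotDr dotZr ![dot (_ + _) _]dotC !(dotDr, dotZr) (dotC s x) /b; lra.
have ab_gt0 : 0 < a + b by rewrite ltr_wpDr.
(* With a = (x, x - s) and b = |x - s|^2, the squared norm at parameter t is
   |x|^2 - t (2 a - t b); this t is at most 1 and has t b <= a. *)
pose t := a / (a + b).
have t_gt0 : 0 < t by rewrite divr_gt0.
have tab : t * (a + b) = a by rewrite divfK // gt_eqF.
have t_le1 : t <= 1 by rewrite ler_pdivrMr // mul1r lerDl.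
have := xmin t; rewrite (ltW t_gt0) t_le1 => /(_ isT) /=.
rewrite dotDr !dotZr ![dot (_ + _) _]dotC !(dotDr, dotZr) (dotC s x).
have -> : (1 - t) * ((1 - t) * dot x x + t * dot x s) +
   t * ((1 - t) * dot x s + t * dot s s) = dot x x - t * (2 * a - t * b).
  by rewrite /a /b; ring.
rewrite lerDl oppr_ge0 pmulr_rle0 //.
have ta : 0 <= t * a by rewrite mulr_ge0 // ltW.
have : t * b = a - t * a by rewrite -{1}tab; ring.
lra.
Qed.

(** * Continuity *)

Lemma continuous_mx_coord (T : topologicalType) (m n : nat) (i : 'I_m)
    (j : 'I_n) :
  continuous (fun M : 'M[T]_(m, n) => M i j).
Proof.
move=> M A MA.
exists (fun i' j' => if (i' == i) && (j' == j) then A else setT).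
  move=> i' j'; case: ifPn => [/andP[/eqP -> /eqP ->]//|_]; exact: filterT.
by move=> N /(_ i j) /=; rewrite !eqxx.
Qed.

Lemma continuous_mx (T U : topologicalType) (m n : nat)
    (g : U -> 'M[T]_(m, n)) :
  (forall i j, continuous (fun t => g t i j)) -> continuous g.
Proof.
move=> gc t A [P tP subA].
have : \forall s \near t, forall ij : 'I_m * 'I_n, P ij.1 ij.2 (g s ij.1 ij.2).
  by apply: filter_forall => -[i j] /=; apply: gc; exact: tP.
by apply: filterS => s Ps; apply: subA => i j; exact: (Ps (i, j)).
Qed.

Lemma continuous_sum (R : realType) (U : topologicalType) (m : nat)
    (F : 'I_m -> U -> R) :
  (forall i, continuous (F i)) -> continuous (fun t => \sum_i F i t).
Proof. by move=> Fc; apply: continuous_big => //; exact: add_continuous. Qed.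

Lemma continuous_mul (R : realType) (U : topologicalType) (f g : U -> R) :
  continuous f -> continuous g -> continuous (fun t => f t * g t).
Proof. by move=> fc gc t; apply: cvgM; [exact: fc|exact: gc]. Qed.

Lemma continuous_scale (R : realType) (U : topologicalType) (c : R)
    (g : U -> R) :
  continuous g -> continuous (fun t => c * g t).
Proof.
by move=> gc; apply: (@continuous_mul _ _ (fun=> c)) => // t; exact: cvg_cst.
Qed.

Lemma continuous_dot (R : realType) (n : nat) :
  continuous (fun x : 'rV[R]_n => dot x x).
Proof.
rewrite (_ : (fun x => _) = fun x : 'rV[R]_n => \sum_k x 0 k * x 0 k).
  apply: continuous_sum => k.
  by apply: continuous_mul; exact: continuous_mx_coord.
by apply/funext => x; rewrite dotE.
Qed.

(** * Convex hulls of compact sets *)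

(** Fixing the number m of points makes this set a continuous image of a compact
    set of weights and points. *)
Definition conv_hull_of (R : realType) (n m : nat) (S : set 'rV[R]_n)
  : set 'rV[R]_n :=
  [set x | exists y : 'I_m -> 'rV[R]_n, (forall i, S (y i)) /\ conv_hull y x].

Lemma compact_conv_hull_of (R : realType) (n m : nat) (S : set 'rV[R]_n) :
  compact S -> compact (conv_hull_of m S).
Proof.
move=> Sc.
pose W := [set w : 'rV[R]_m | forall i, `[0, 1]%classic (w ord0 i)] `&`
  [set w : 'rV[R]_m | \sum_i w ord0 i = 1].
pose Y := [set y : 'rV['rV[R]_n]_m | forall i, S (y ord0 i)].
have Wc : compact W.
  apply: compact_closedI.
    apply: (@rV_compact R m (fun=> `[0, 1]%classic)) => i.
    exact: segment_compact.
  apply: (@preimage_closed _ _ (fun w : 'rV[R]_m => \sum_i w ord0 i)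
    [set x | x = 1]).
    by move=> w _; apply: continuous_sum => i; exact: continuous_mx_coord.
  exact: closed_eq.
have Yc : compact Y by apply: (@rV_compact (GRing.Zmodule.sort _) m (fun=> S)).
pose F (wy : 'rV[R]_m * 'rV['rV[R]_n]_m) :=
  \sum_i wy.1 ord0 i *: wy.2 ord0 i.
have Fc : continuous F.
  apply: continuous_mx => k j.
  rewrite (_ : (fun t => _) = fun t : 'rV[R]_m * 'rV['rV[R]_n]_m =>
      \sum_i t.1 ord0 i * t.2 ord0 i k j).
    apply: continuous_sum => i; apply: continuous_mul => t.
      apply: (@continuous_comp _ _ _ fst (fun w : 'rV[R]_m => w ord0 i)).
        exact: cvg_fst.
      exact: continuous_mx_coord.
    apply: (@continuous_comp _ _ _
        (fun t : 'rV[R]_m * 'rV['rV[R]_n]_m => t.2 ord0 i)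
        (fun v : 'rV[R]_n => v k j)).
      apply: (@continuous_comp _ _ _ snd
        (fun y : 'rV['rV[R]_n]_m => y ord0 i)); first exact: cvg_snd.
      exact: continuous_mx_coord.
    exact: continuous_mx_coord.
  by apply/funext => t; rewrite summxE; under eq_bigr do rewrite mxE.
suff -> : conv_hull_of m S = F @` (W `*` Y).
  apply: continuous_compact; first exact: continuous_subspaceT.
  exact: compact_setX.
apply/seteqP; split=> [x [y [yS [w [w0 w1 ->]]]]|x [[w y] [[w01 w1] yS] <-]].
  exists (\row_i w i, \row_i y i); last first.
    by apply: eq_bigr => i _; rewrite !mxE.
  split; last by move=> i /=; rewrite mxE.
  split=> [i /=|/=]; last by under eq_bigr do rewrite mxE.
  rewrite mxE in_itv /= w0 /= -w1 (bigD1 i) //= lerDl.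
  exact: sumr_ge0.
exists (fun i => y ord0 i); split=> //; exists (fun i => w ord0 i); split=> //.
by move=> i; have := w01 i; rewrite /= in_itv /= => /andP[].
Qed.

Lemma conv_hull_of_segment (R : realType) (n m : nat) (S : set 'rV[R]_n)
    (x s : 'rV[R]_n) (t : R) :
  conv_hull_of m S x -> S s -> 0 <= t <= 1 ->
  conv_hull_of m.+1 S ((1 - t) *: x + t *: s).
Proof.
move=> [y [yS [w [w0 w1 ->]]]] Ss /andP[t0 t1].
exists (fun i => oapp y s (unlift ord0 i)); split.
  by move=> i; case: unliftP => [j _|_] //=.
exists (fun i => oapp (fun j => (1 - t) * w j) t (unlift ord0 i)); split.
- move=> i; case: unliftP => [j _|_] //=.
  by rewrite mulr_ge0 // subr_ge0.
- rewrite big_ord_recl unlift_none /=.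
  under eq_bigr do rewrite liftK /=.
  by rewrite -mulr_sumr w1 mulr1 addrC subrK.
- rewrite [RHS]big_ord_recl unlift_none /= addrC; congr (_ + _).
  rewrite scaler_sumr; apply: eq_bigr => i _.
  by rewrite liftK /= scalerA.
Qed.

(** Caratheodory in R^n: n + 1 points suffice, hence with [conv_hull_of_segment]
    the sets [conv_hull_of n.+1 S] absorb segments towards points of S. *)
Lemma conv_hull_of_stable (R : realType) (n : nat) (S : set 'rV[R]_n) :
  conv_hull_of n.+2 S `<=` conv_hull_of n.+1 S.
Proof.
move=> x [y [yS hull_x]].
have [i||w [w0 w1 -> [k wk]]] :=
  @caratheodory_step _ _ _ (1%:M : 'M[R]_n) y x _ _ hull_x.
- exact: submx1.
- by rewrite mxrank1.
- by exists (fun i => y (lift k i)); split=> //; exact: drop_zero_weight.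
Qed.

(** If the point x of least norm of the hull is not 0, then it separates the
    hull from 0, with c = |x|^2.  Linear conditions satisfied by all points of
    S pass to x because x is in the hull. *)
Lemma origin_or_separated (R : realType) (n : nat) (S : set 'rV[R]_n) :
  compact S -> S !=set0 ->
  conv_hull_of n.+1 S 0 \/
  exists x c, [/\ conv_hull_of n.+1 S x, 0 < c & forall s, S s -> c <= dot x s].
Proof.
move=> Sc [s0 Ss0].
have C0 : conv_hull_of n.+1 S !=set0.
  exists s0; exists (fun=> s0); split=> //; exists (fun i => (i == ord0)%:R).
  split=> [i||]; first exact: ler0n.
    by rewrite (bigD1 ord0) //= big1 ?addr0 // => i /negPf ->.
  rewrite (bigD1 ord0) //= big1 ?addr0 ?scale1r // => i /negPf ->.
  by rewrite scale0r.
have [x xC xmin] := compact_EVT_min C0 (compact_conv_hull_of (m := n.+1) Sc)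
  (continuous_subspaceT (@continuous_dot R n)).
rewrite inE in xC.
have sep s : S s -> dot x x <= dot x s.
  move=> Ss; apply: min_norm_segment => t t01 /=; apply: xmin; rewrite inE.
  by apply: conv_hull_of_stable; exact: conv_hull_of_segment.
have [xx0|xx0] := eqVneq (dot x x) 0.
  by left; rewrite -(dot_eq0 xx0).
by right; exists x, (dot x x); split=> //; rewrite lt_def xx0 dot_ge0.
Qed.

(** * The uniform norm and polynomials *)

Lemma unif_norm_ub (R : realType) (K : topologicalType) (g : K -> R) :
  compact [set: K] -> continuous g -> forall t, `|g t| <= unif_norm g.
Proof.
move=> Kc gc t; apply: ub_le_sup; last by exists t.
have normc : continuous (fun t => `|g t|).
  move=> s; apply: (@continuous_comp _ _ _ g (fun x : R => `|x|)).
    exact: gc.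
  exact: norm_continuous.
have K0 : [set: K] !=set0 by exists t.
have [s _ smax] := compact_EVT_max K0 Kc (continuous_subspaceT normc).
by exists `|g s| => _ [u _ <-]; apply: smax; rewrite inE.
Qed.

Lemma unif_norm_le (R : realType) (K : Type) (g : K -> R) (t0 : K) (a : R) :
  (forall t, `|g t| <= a) -> unif_norm g <= a.
Proof.
move=> ga; apply: ge_sup; first by exists `|g t0|, t0.
by move=> _ [t _ <-].
Qed.

Lemma poly_fun_dot (R : realType) (K : Type) (n : nat) (phi : 'I_n -> K -> R)
    (p : 'rV[R]_n) (t : K) :
  poly_fun phi p t = dot p (moment phi t).
Proof. by rewrite dotE; apply: eq_bigr => k _; rewrite mxE. Qed.

Lemma poly_funB (R : realType) (K : Type) (n : nat) (phi : 'I_n -> K -> R)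
    (p q : 'rV[R]_n) (a : R) (t : K) :
  poly_fun phi (p - a *: q) t = poly_fun phi p t - a * poly_fun phi q t.
Proof.
by rewrite !poly_fun_dot dotC -scaleNr dotDr dotZr mulNr !(dotC (moment _ _)).
Qed.

Lemma continuous_poly_fun (R : realType) (K : topologicalType) (n : nat)
    (phi : 'I_n -> K -> R) (p : 'rV[R]_n) :
  (forall k, continuous (phi k)) -> continuous (poly_fun phi p).
Proof.
move=> phic; apply: (@continuous_sum _ _ _ (fun k t => p 0 k * phi k t)) => k.
exact: continuous_scale.
Qed.

Lemma continuous_error (R : realType) (K : topologicalType) (n : nat)
    (phi : 'I_n -> K -> R) (f : K -> R) (p : 'rV[R]_n) :
  (forall k, continuous (phi k)) -> continuous f ->
  continuous (fun t => poly_fun phi p t - f t).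
Proof.
move=> phic fc t; apply: continuousB; last exact: fc.
exact: continuous_poly_fun.
Qed.

(** * The subspace orthogonal to the constraints *)

Lemma functional_mx_apply (R : realType) (n r : nat)
    (ell : 'I_r -> {scalar 'rV[R]_n}) (v : 'rV[R]_n) (j : 'I_r) :
  ell j v = (v *m (functionals_mx ell)^T) 0 j.
Proof.
rewrite {1}[v]row_sum_delta linear_sum mxE; apply: eq_bigr => k _.
by rewrite linearZ !mxE.
Qed.

Lemma L_perpP (R : realType) (n r : nat) (ell : 'I_r -> {scalar 'rV[R]_n})
    (v : 'rV[R]_n) :
  (v <= L_perp ell)%MS <-> forall j, ell j v = 0.
Proof.
split=> [/sub_kermxP v0 j|v0]; first by rewrite functional_mx_apply v0 mxE.
by apply/sub_kermxP/rowP => j; rewrite -functional_mx_apply v0 mxE.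
Qed.

Lemma rank_L_perp (R : realType) (n r : nat)
    (ell : 'I_r -> {scalar 'rV[R]_n}) :
  lin_indep (fun j (p : 'rV[R]_n) => ell j p) -> \rank (L_perp ell) = (n - r)%N.
Proof.
move=> indep; rewrite mxrank_ker mxrank_tr; congr (_ - _)%N; apply/eqP.
rewrite -/(row_free _) -kermx_eq0 -submx0; apply/rV_subP => c /sub_kermxP cA.
suff -> : c = 0 by rewrite sub0mx.
apply/rowP => j; rewrite [RHS]mxE; apply: (indep (c 0)) => p.
transitivity (dot c (p *m (functionals_mx ell)^T)).
  by rewrite dotE; apply: eq_bigr => i _; rewrite functional_mx_apply.
by rewrite /dot trmx_mul trmxK mulmxA cA mul0mx mxE.
Qed.

(** Orthogonal projection onto V is self-adjoint and fixes V.  This is how a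
    relation between projected moment vectors becomes a relation between
    values of polynomials. *)
Lemma dot_ortho_proj (R : realType) (n : nat) (V : 'M[R]_n) (v x : 'rV[R]_n) :
  (v <= V)%MS -> dot v (x *m ortho_proj V) = dot v x.
Proof.
move=> vV; have [_ /(_ v vV)/matrixP/(_ 0 0)] := ortho_projP V x.
rewrite mulmxBl mxE [X in _ + X]mxE [RHS]mxE => /eqP; rewrite subr_eq0.
by rewrite -!/(dot _ _) ![dot v _]dotC => /eqP.
Qed.

Lemma dot_row_mx (R : realType) (n1 n2 : nat) (a c : 'rV[R]_n1)
    (b d : 'rV[R]_n2) :
  dot (row_mx a b) (row_mx c d) = dot a c + dot b d.
Proof. by rewrite /dot tr_row_mx mul_row_col mxE. Qed.

(** * Existence and sharing of the alternance *)

(** The polynomial p - x / lam is strictly better than p: the hypothesis says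
    that s (e - x / lam) <= E - c / lam for both signs s. *)
Lemma not_best_of_descent (R : realType) (K : Type) (n r : nat)
    (phi : 'I_n -> K -> R) (ell : 'I_r -> {scalar 'rV[R]_n}) (b : 'I_r -> R)
    (f : K -> R) (p x : 'rV[R]_n) (t0 : K) (lam c : R) :
  let e t := poly_fun phi p t - f t in
  (x <= L_perp ell)%MS -> 0 <= lam -> 0 < c ->
  (forall s t, s = -1 \/ s = 1 ->
     c <= s * poly_fun phi x t + lam * (unif_norm e - s * e t)) ->
  ~ best_approx phi ell b f p.
Proof.
move=> e /L_perpP xL lam_ge0 c_gt0 descent [pb pmin].
have up t : c <= poly_fun phi x t + lam * (unif_norm e - e t).
  by have := descent 1 t (or_intror erefl); rewrite !mul1r.
have down t : c <= - poly_fun phi x t + lam * (unif_norm e + e t).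
  by have := descent (-1) t (or_introl erefl); rewrite !mulN1r opprK.
have lam_gt0 : 0 < lam.
  rewrite lt_def lam_ge0 andbT; apply/eqP => lam0.
  by have := up t0; have := down t0; rewrite lam0 !mul0r; lra.
pose q := p - lam^-1 *: x.
have qb j : ell j q = b j by rewrite linearB linearZ /= xL pb mulr0 subr0.
have := pmin q qb; apply/negP; rewrite -ltNge.
apply: (@le_lt_trans _ _ (unif_norm e - c / lam)); last first.
  by rewrite gtrBl divr_gt0.
apply: (unif_norm_le t0) => t.
have -> : poly_fun phi q t - f t = e t - poly_fun phi x t / lam.
  by rewrite poly_funB /e mulrC addrAC.
have scaled : `|lam * e t - poly_fun phi x t| <= lam * unif_norm e - c.
  by rewrite ler_norml; have := up t; have := down t; lra.
rewrite -(ler_pM2l lam_gt0) -{1}(gtr0_norm lam_gt0) -normrM.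
rewrite (mulrBr lam (e t)) (mulrBr lam (unif_norm e)).
by rewrite ![lam * (_ / lam)]mulrC !divfK ?gt_eqF.
Qed.

(** The vectors v(s, t) = (P(s u(t)), E - s e(t)) turn the two conditions on an
    alternance, extremality of the points and the origin being in the hull of
    the projections, into the one condition that 0 lies in their convex hull. *)
Lemma positive_alternance (R : realType) (K : topologicalType)
    (n r : nat) (phi : 'I_n -> K -> R) (ell : 'I_r -> {scalar 'rV[R]_n})
    (b : 'I_r -> R) (f : K -> R) (p : 'rV[R]_n) (t0 : K) :
  let e t := poly_fun phi p t - f t in
  compact [set: K] -> (forall k, continuous (phi k)) -> continuous f ->
  best_approx phi ell b f p ->
  exists m (tau : 'I_m -> K) (sigma w : 'I_m -> R),
    [/\ (m <= (\rank (L_perp ell)).+1)%N,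
        forall i, 0 < w i /\ (sigma i = -1 \/ sigma i = 1),
        \sum_i w i = 1,
        forall i, e (tau i) = sigma i * unif_norm e
      & \sum_i w i *:
          ((sigma i *: moment phi (tau i)) *m ortho_proj (L_perp ell)) = 0].
Proof.
move=> e Kc phic fc best.
have ec : continuous e by exact: continuous_error.
pose P := ortho_proj (L_perp ell).
pose a s t := (s *: moment phi t) *m P.
pose d s t := unif_norm e - s * e t.
pose v s t : 'rV[R]_(n + 1) := row_mx (a s t) (const_mx (d s t)).
have aL s t : (a s t <= L_perp ell)%MS.
  by have [] := ortho_projP (L_perp ell) (s *: moment phi t).
have d_ge0 s t : s = -1 \/ s = 1 -> 0 <= d s t.
  have := unif_norm_ub Kc ec t; rewrite /d ler_norml => /andP[? ?].
  by move=> [] ->; lra.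
have vc s : continuous (v s).
  apply: continuous_mx => i j.
  rewrite -(splitK j); case: (fintype.split j) => k /=.
    rewrite (_ : (fun t => _) = fun t => \sum_l s * P l k * phi l t).
      by apply: continuous_sum => l; exact: continuous_scale.
    apply/funext => t; rewrite row_mxEl mxE; apply: eq_bigr => l _.
    by rewrite !mxE mulrAC.
  rewrite (_ : (fun t => _) = fun t => unif_norm e - s * e t); last first.
    by apply/funext => t; rewrite row_mxEr mxE.
  by move=> t; apply: cvgB; [exact: cvg_cst|exact: continuous_scale].
pose S := v 1 @` [set: K] `|` v (-1) @` [set: K].
have Sv s : S s ->
    exists st : R * K, (st.1 = -1 \/ st.1 = 1) /\ s = v st.1 st.2.
  by move=> [[t _ <-]|[t _ <-]]; [exists (1, t)|exists (-1, t)]; split; auto.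
have Sc : compact S.
  apply: compactU; apply: continuous_compact => //;
    exact: continuous_subspaceT.
have S0 : S !=set0 by exists (v 1 t0); left; exists t0.
case: (origin_or_separated Sc S0) => [|[x [c [xS c_gt0 sep]]]]; last first.
  exfalso; case: xS => y [yS [w [w0 w1 xE]]].
  have xL : (lsubmx x <= L_perp ell)%MS.
    rewrite xE linear_sum; apply: summx_sub => i _; rewrite linearZ /=.
    by have [st [_ ->]] := Sv _ (yS i); rewrite /v row_mxKl scalemx_sub.
  have lam_ge0 : 0 <= rsubmx x 0 0.
    rewrite xE linear_sum summxE; apply: sumr_ge0 => i _; rewrite linearZ.
    have [st [sgn ->]] := Sv _ (yS i).
    by rewrite /= /v row_mxKr !mxE mulr_ge0 // d_ge0.
  apply: (not_best_of_descent t0 xL lam_ge0 c_gt0 _ best) => s t sgn.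
  have /sep : S (v s t) by case: sgn => ->; [right|left]; exists t.
  rewrite -{1}(hsubmxK x) dot_row_mx dot_ortho_proj // dotZr -poly_fun_dot.
  by rewrite dotE big_ord1 [const_mx _ _ _]mxE.
move=> [y [yS hull0]].
have y1 i : (y i <= (1%:M : 'M[R]_(n + 1)))%MS by exact: submx1.
have [m [h [w [_ w0 w1 vw]]]] := caratheodory y1 hull0.
have [st stP] := choice (fun i => Sv _ (yS (h i))).
have aw : \sum_i w i *: a (st i).1 (st i).2 = 0.
  have := congr1 lsubmx vw; rewrite linear0 linear_sum => /esym; apply: etrans.
  apply: eq_bigr => i _; have [_ ->] := stP i.
  by rewrite linearZ /= /v row_mxKl.
have dw : \sum_i w i * d (st i).1 (st i).2 = 0.
  have /matrixP/(_ 0 0) := congr1 rsubmx vw.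
  rewrite linear0 mxE linear_sum summxE => /esym; apply: etrans.
  apply: eq_bigr => i _; have [_ ->] := stP i.
  by rewrite linearZ /= /v row_mxKr !mxE.
(* A vanishing positive combination of the nonnegative last coordinates. *)
have active i : d (st i).1 (st i).2 = 0.
  have wd_ge0 j : 0 <= w j * d (st j).1 (st j).2.
    by rewrite mulr_ge0 ?d_ge0 //; [exact: ltW|have [] := stP j].
  have /eqP := dw; rewrite psumr_eq0 // => /allP/(_ i).
  by rewrite mem_index_enum mulf_eq0 gt_eqF //= => /(_ isT)/eqP.
have hull_a : conv_hull (fun i => a (st i).1 (st i).2) 0.
  by exists w; split=> // i; exact: ltW.
have [m' [h' [w' [small w'0 w'1 aw']]]] :=
  caratheodory (fun i => aL (st i).1 (st i).2) hull_a.
exists m', (fun i => (st (h' i)).2), (fun i => (st (h' i)).1), w'; split=> //.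
  by move=> i; split=> //; have [] := stP (h' i).
move=> i; have [sgn _] := stP (h' i); have := active (h' i); rewrite /d.
by move=> /eqP; rewrite subr_eq0 => /eqP ->; case: sgn => ->; lra.
Qed.

Lemma best_approx_norm (R : realType) (K : Type) (n r : nat)
    (phi : 'I_n -> K -> R) (ell : 'I_r -> {scalar 'rV[R]_n}) (b : 'I_r -> R)
    (f : K -> R) (p q : 'rV[R]_n) :
  best_approx phi ell b f p -> best_approx phi ell b f q ->
  unif_norm (fun t => poly_fun phi p t - f t) =
  unif_norm (fun t => poly_fun phi q t - f t).
Proof. by move=> [pb pmin] [qb qmin]; apply/le_anti; rewrite pmin // qmin. Qed.

(** The alternance relation annihilates p - q, so the nonnegative
    numbers sigma_i (p - q)(tau_i) have a vanishing positive combination. *)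
Lemma eq_on_positive_alternance (R : realType) (K : Type) (n r m : nat)
    (phi : 'I_n -> K -> R) (ell : 'I_r -> {scalar 'rV[R]_n}) (f : K -> R)
    (p q : 'rV[R]_n) (tau : 'I_m -> K) (sigma w : 'I_m -> R) :
  (forall j, ell j p = ell j q) ->
  (forall i, 0 < w i) ->
  (forall i, sigma i = -1 \/ sigma i = 1) ->
  \sum_i w i *:
    ((sigma i *: moment phi (tau i)) *m ortho_proj (L_perp ell)) = 0 ->
  (forall i, sigma i * (poly_fun phi q (tau i) - f (tau i)) <=
             sigma i * (poly_fun phi p (tau i) - f (tau i))) ->
  forall i, poly_fun phi p (tau i) = poly_fun phi q (tau i).
Proof.
move=> pq w_gt0 sgn w0 qp i.
have pqL : (p - q <= L_perp ell)%MS.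
  by apply/L_perpP => j; rewrite linearB pq subrr.
pose g j := w j * (sigma j * (poly_fun phi p (tau j) - poly_fun phi q (tau j))).
have g_ge0 j : 0 <= g j.
  by apply: mulr_ge0; [exact: ltW|have := qp j; lra].
have : \sum_j g j == 0.
  have := congr1 (dot (p - q)) w0; rewrite dot_sumr {2}/dot trmx0 mulmx0 mxE.
  move=> dot0; apply/eqP; rewrite -[RHS]dot0; apply: eq_bigr => j _.
  rewrite dot_ortho_proj // dotZr -poly_fun_dot -[q]scale1r poly_funB.
  by rewrite mul1r.
rewrite psumr_eq0 // => /allP/(_ i); rewrite mem_index_enum /g.
rewrite mulf_eq0 gt_eqF //= => /(_ isT)/eqP.
by case: (sgn i) => ->; lra.
Qed.

Theorem theorem7 (R : realType) (K : metricType R)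
  (K_compact : compact [set: K])
  (n r : nat) (lt_rn : (r < n)%N)
  (phi : 'I_n -> K -> R) (phi_cont : forall k, continuous (phi k))
  (phi_indep : lin_indep phi)
  (ell : 'I_r -> {scalar 'rV[R]_n})
  (ell_indep : lin_indep (fun j (p : 'rV[R]_n) => ell j p))
  (b : 'I_r -> R)
  (f : K -> R) (f_cont : continuous f) :
  exists (m : nat) (tau : 'I_m -> K),
    (forall p : 'rV[R]_n, best_approx phi ell b f p ->
       L_alternance phi ell f p tau) /\
    (forall p q : 'rV[R]_n,
       best_approx phi ell b f p -> best_approx phi ell b f q ->
       forall i, poly_fun phi p (tau i) = poly_fun phi q (tau i)).
Proof.
have [[p pbest]|/forallNP nobest] :=
    pselect (exists p, best_approx phi ell b f p); last first.
  (* Without a best approximant both claims are vacuous for the empty family. *)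
  have tau (i : 'I_0) : K by case: i.
  by exists 0%N, tau; split=> p => [|q] /nobest.
(* On an empty K every relation between the functions phi_k would hold. *)
have [t0] : exists t : K, True.
  apply: contrapT => noK.
  have /(_ (Ordinal lt_rn))/eqP := phi_indep (fun=> 1)
    (fun t => False_ind _ (noK (ex_intro _ t I))).
  by rewrite oner_eq0.
move=> _.
have [m [tau [sigma [w [m_le wsgn w1 ptau w0]]]]] :=
  positive_alternance t0 K_compact phi_cont f_cont pbest.
have w_gt0 i : 0 < w i by have [] := wsgn i.
have sgn i : sigma i = -1 \/ sigma i = 1 by have [] := wsgn i.
have agree q : best_approx phi ell b f q ->
    forall i, poly_fun phi p (tau i) = poly_fun phi q (tau i).
  move=> qbest.
  apply: (eq_on_positive_alternance (f := f) (ell := ell)) w0 _ => //.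
    by move=> j; rewrite (pbest.1 j) (qbest.1 j).
  move=> i; rewrite ptau mulrA.
  have -> : sigma i * sigma i = 1 by case: (sgn i) => ->; ring.
  rewrite mul1r (best_approx_norm pbest qbest).
  have := unif_norm_ub K_compact
    (continuous_error (p := q) phi_cont f_cont) (tau i).
  rewrite ler_norml => /andP[].
  by case: (sgn i) => -> ? ?; lra.
exists m, tau; split=> [q qbest|q q' qbest q'best i]; last first.
  by rewrite -(agree q qbest) -(agree q' q'best).
split.
  rewrite -(rank_L_perp ell_indep) addn1 m_le andbT lt0n.
  apply: contra_eqN w1 => /eqP m0.
  rewrite big1 ?[0 == 1]eq_sym ?oner_eq0 // => i _.
  by have := ltn_ord i; rewrite {2}m0.
exists sigma; split=> // [i|].
  by rewrite -(agree q qbest) ptau (best_approx_norm pbest qbest).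
by exists w; split=> // i; exact: ltW.
Qed.
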